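(* Let $c>1$, let $N$ be a positive integer, and let $\alpha$ be the Lebesgue measure on $[-1,1]$. Then $$J_+(\mathcal{E}_c;N)\geq 2\left(\left(\frac{c^2-1+c}{c^2-1}\right)^{(c^2-1)/c}\left(\frac{c^2-1+c}{c}\right)\right)^{-2N}.$$
   Context: For $c>1$, $\mathcal{E}_c$ is the interior of the ellipse with foci $\pm 1$ and sum of semi-axes equal to $c$; that is, $\mathcal{E}_c=\{x+iy: x^2/a^2+y^2/b^2<1\}$ with $a=(c^2+1)/(2c)$, $b=(c^2-1)/(2c)$. $\mathbb{D}$ is the open unit disk and $\mathcal{O}(D,\mathbb{D})$ is the set of holomorphic functions from $D$ to $\mathbb{D}$. For a domain $D\supset[-1,1]$, $X=(x_1,\dots,x_n)$ with $-1\le x_1<\dots<x_n\le 1$ and positive integers $\mathcal{K}=(k_1,\dots,k_n)$, let $\mathcal{F}_+(D;X;\mathcal{K})$ be the set of all $f\in\mathcal{O}(D,\mathbb{D})$ such that $f^{(l)}(x_j)=0$ for $l=0,\dots,k_j-1$, $j=1,\dots,n$, and $f$ is real-valued with $f\ge 0$ on $D\cap\mathbb{R}$. Define $$J_+(D;X;\mathcal{K}):=\sup\left\{\left|\int_{-1}^1 g(x)\,d\alpha(x)\right|: g\in\mathcal{F}_+(D;X;\mathcal{K})\right\},$$ $$J_+(D;N):=\inf\{J_+(D;(x_1,\dots,x_n);(k_1,\dots,k_n)): n\in\mathbb{N},\ n\ge 1,\ -1\le x_1<\dots<x_n\le 1,\ k_1+\dots+k_n=N\},$$ where the $k_j$ are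 positive integers. *)

(* Defs.v *)
From HB Require Import structures.
From mathcomp Require Import all_boot all_order all_algebra.
From mathcomp Require Import all_classical all_reals all_analysis.
From mathcomp Require Export complex.

Set Implicit Arguments.
Unset Strict Implicit.
Unset Printing Implicit Defensive.

Import Order.TTheory GRing.Theory Num.Theory.
Import numFieldNormedType.Exports.

Local Open Scope classical_set_scope.
Local Open Scope ring_scope.
Local Open Scope complex_scope.

(* The next two definitions are stated over an abstract field K because the
   library puts the norm topology on the carrier of any numFieldType but not
   on the concrete type R[i]. They are used at K = R[i], where derivability in
   the direction 1 is complex differentiability. *)

(* The set O(D, E). Its members are total functions whose values outside D are
   irrelevant. *)
Definition holomorphic_maps (K : numFieldType) (D E : set K) : set (K -> K) :=
  [set f | forall z, D z -> derivable f z 1 /\ E (f z)].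

Definition vanishes_to_order (K : numFieldType) (f : K -> K) (z : K) (m : nat) :
    Prop :=
  forall l : nat, (l < m)%N -> derive1n l f z = 0.

Section Definitions.
Variable R : realType.

(* The interior of the ellipse with foci -1 and 1 and sum of semi-axes c. *)
Definition ellipse (c : R) : set R[i] :=
  let a := (c ^+ 2 + 1) / (2 * c) in
  let b := (c ^+ 2 - 1) / (2 * c) in
  [set z | complex.Re z ^+ 2 / a ^+ 2 + complex.Im z ^+ 2 / b ^+ 2 < 1].

Definition unit_disk : set R[i] := [set z | `|z| < 1].

(* In R[i], 0 <= w means that w is real and nonnegative. *)
Definition Fplus (D : set R[i]) (n : nat) (x : 'I_n -> R) (k : 'I_n -> nat) :
    set (R[i] -> R[i]) :=
  [set f | [/\ holomorphic_maps D unit_disk f,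
      forall j : 'I_n, vanishes_to_order f (x j)%:C (k j) &
      forall t : R, D t%:C -> 0 <= f t%:C]].

(* When D contains [-1, 1], every g in Fplus D x k is real on [-1, 1], so that
   the integral of g there is the integral of its real part. *)
Definition Jplus_at (mu : {measure set (measurableTypeR R) -> \bar R})
    (D : set R[i]) (n : nat) (x : 'I_n -> R) (k : 'I_n -> nat) : \bar R :=
  ereal_sup [set `|\int[mu]_(t in `[(-1)%R, 1%R]) (complex.Re (g t%:C))%:E|%E
            | g in Fplus D x k].

Definition Jplus (mu : {measure set (measurableTypeR R) -> \bar R})
    (D : set R[i]) (N : nat) : \bar R :=
  ereal_inf [set J | exists (n : nat) (x : 'I_n -> R) (k : 'I_n -> nat),
    [/\ (1 <= n)%N,
        forall j, -1 <= x j <= 1,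
        forall i j : 'I_n, (i < j)%N -> x i < x j,
        (forall j, (0 < k j)%N) /\ (\sum_(j < n) k j = N)%N &
        J = Jplus_at mu D x k]].

End Definitions.

(* Main.v *)
Require Import Defs.
From mathcomp Require Import all_boot all_order all_algebra.
From mathcomp Require Import all_classical all_reals all_analysis.
From mathcomp Require Import ring lra.
Import Order.TTheory GRing.Theory Num.Theory.
Import numFieldNormedType.Exports.
Local Open Scope classical_set_scope.
Local Open Scope ring_scope.

(** Lower bound, by an explicit competitor and Jensen's inequality.

    Let b be the minor semi-axis of the ellipse, so that 2b = (c^2 - 1)/c. The
    ellipse lies in the strip |Im z| < b, and for a real node s the function
      psi_s(z) = (z - s)^2 / ((z - s)^2 + 2 b^2)
    maps that strip into the unit disk: |w| < |w + 2 b^2| means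
    Re w > - b^2, and Re (z - s)^2 = (Re z - s)^2 - (Im z)^2 > - b^2
    ([sqr_norm_lt_shift]). It is nonnegative on the real line and has a double
    zero at s. Hence g = prod_j psi_{x_j}^{k_j} is admissible for every choice
    of nodes and multiplicities ([node_product_Fplus]), and it remains to bound
    its integral below, uniformly in the nodes.

    On the real line t^2 + 2 b^2 <= (|t| + 2b)^2, so log g(t) is at least the
    sum of the k_j * 2 log (|t - x_j| / (|t - x_j| + 2b)). By Jensen's
    inequality ([exp_mean_le_integral]) the integral of g over [-1, 1] is at
    least 2 exp(M / 2), where M is the integral of this sum. Since
    log (r / (r + 2b)) increases with r >= 0, each term is smallest when its
    node is the centre of [-1, 1]
    ([odd_log_ratio_primitive_increment]); the integral is then elementary and
      - int_0^1 log (r / (r + 2b)) dr = (1 + 2b) log (1 + 2b) - 2b log (2b)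
    is the logarithm of the number raised to the power -2N in the bound.

    The logarithms are singular at the nodes. Improper integrals are avoided by
    working with primitives: x log x extends continuously to 0, and a continuous
    function whose derivative is nonnegative off a finite set is nondecreasing
    ([le_of_derive_ge0_off_finite]). *)

(** * Zeros of rational functions over a normed field *)

Lemma is_derive_horner_num (K : numFieldType) (p : {poly K}) (x : K) :
  is_derive x 1 (horner p) (p^`()).[x].
Proof.
elim/poly_ind: p => [|p r ih].
  rewrite (_ : horner 0 = cst 0); last by apply/funext => y; rewrite horner0.
  by rewrite deriv0 horner0; exact: is_derive_cst.
rewrite (_ : horner _ = horner p * id + cst r); last first.
  by apply/funext => y; rewrite !hornerE.
apply: is_derive_eq.
by rewrite !poly.derivE !hornerE /= /GRing.scale /=; ring.
Qed.

Lemma is_derive_rational (K : numFieldType) (p q : {poly K}) (x : K) :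
  q.[x] != 0 ->
  is_derive x 1 (fun z => p.[z] / q.[z])
    ((p^`() * q - p * q^`()).[x] / (q ^+ 2).[x]).
Proof.
move=> qx0; have dp := is_derive_horner_num K p x.
have [dq dqE] := is_derive_horner_num K q x.
have dV : is_derive x 1 (fun z => (q.[z])^-1) (- q.[x] ^- 2 *: (q^`()).[x]).
  by apply: DeriveDef; [exact: derivableV | rewrite deriveV // dqE].
apply: (is_derive_eq (is_deriveM dp dV)).
by rewrite !hornerE /= /GRing.scale /=; field.
Qed.

Lemma near_horner_neq0 (K : numFieldType) (q : {poly K}) (x : K) :
  q.[x] != 0 -> \forall z \near x, q.[z] != 0.
Proof.
move=> qx0; have [dq _] := is_derive_horner_num K q x.
have /differentiable_continuous cq : differentiable (horner q) x.
  exact/derivable1_diffP.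
exact: (cvgr_neq0 _ cq qx0).
Qed.

(** Induction on the order of derivation. The quotient rule replaces the
    numerator by p' q - p q', which is divisible by one power of X - x less. The
    equality with p / q is only required near x because the derivative formula
    holds only where q does not vanish. *)
Lemma vanishes_near_rational (K : numFieldType) (x : K) (m : nat)
    (f : K -> K) (p q : {poly K}) :
  (\forall z \near x, f z = p.[z] / q.[z]) -> q.[x] != 0 ->
  ('X - x%:P) ^+ m %| p -> vanishes_to_order f x m.
Proof.
move=> fpq qx0 dvp l.
elim: l m f p q fpq qx0 dvp => [|l IH] [|m] f p q fpq qx0 dvp //.
  move=> _; rewrite derive1n0 (nbhs_singleton fpq).
  suff /rootP -> : root p x by rewrite mul0r.
  by rewrite -dvdp_XsubCl (dvdp_trans _ dvp)// exprS dvdp_mulIl.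
rewrite ltnS => lm; rewrite /derive1n iterSr -/(derive1n _ _).
apply: (IH m _ (p^`() * q - p * q^`()) (q ^+ 2)) => //.
- have qn := near_horner_neq0 K q x qx0.
  have fn := near_join fpq.
  near=> z.
  have fz : \forall w \near z, f w = p.[w] / q.[w] by near: z.
  rewrite derive1E (near_eq_derive _ fz).
  by apply: derive_val; apply: is_derive_rational; near: z.
- by rewrite horner_exp expf_neq0.
- case/dvdpP: dvp => r ->.
  have dE : ('X - x%:P) ^+ m %| ('X - x%:P) ^+ m.+1 by rewrite exprS dvdp_mull.
  apply: dvdp_sub; last by rewrite dvdp_mulr// dvdp_mull.
  rewrite dvdp_mulr// derivM dvdp_add ?dvdp_mull//.
  by rewrite deriv_exp derivXsubC mul1r -mulr_natr dvdp_mulr.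
Unshelve. all: by end_near. Qed.

Lemma vanishes_rational (K : numFieldType) (x : K) (m : nat) (p q : {poly K}) :
  q.[x] != 0 -> ('X - x%:P) ^+ m %| p ->
  vanishes_to_order (fun z => p.[z] / q.[z]) x m.
Proof.
move=> qx0 dvp; apply: (vanishes_near_rational _ _ _ _ p q) => //.
by near=> z.
Unshelve. all: by end_near. Qed.

(** * The competitor *)

Local Open Scope complex_scope.

(** The field is a parameter so that the same expression gives both the
    holomorphic competitor, over R[i], and its restriction to the real line. *)
Definition node_product {F : fieldType} (kappa : F) {n : nat} (x : 'I_n -> F)
    (k : 'I_n -> nat) (z : F) : F :=
  \prod_(j < n) ((z - x j) ^+ 2 / ((z - x j) ^+ 2 + kappa)) ^+ k j.

Lemma node_product_rational (F : fieldType) (kappa : F) (n : nat)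
    (x : 'I_n -> F) (k : 'I_n -> nat) (z : F) :
  node_product kappa x k z =
  (\prod_(j < n) (('X - (x j)%:P) ^+ 2) ^+ k j).[z] /
  (\prod_(j < n) (('X - (x j)%:P) ^+ 2 + kappa%:P) ^+ k j).[z].
Proof.
rewrite !horner_prod -prodf_div; apply: eq_bigr => j _.
by rewrite expr_div_n !hornerE.
Qed.

Lemma node_product_real_complex (R : realType) (kappa : R) (n : nat)
    (x : 'I_n -> R) (k : 'I_n -> nat) (t : R) :
  node_product kappa%:C (fun j => (x j)%:C) k t%:C =
  (node_product kappa x k t)%:C.
Proof.
rewrite /node_product rmorph_prod; apply: eq_bigr => j _.
by rewrite rmorphXn fmorph_div /= rmorphD !rmorphXn rmorphB.
Qed.

(** With w = (z - s)^2, the inequality says that w lies to the right of the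
    line Re w = - b^2, the perpendicular bisector of 0 and - 2 b^2. *)
Lemma sqr_norm_lt_shift (R : realType) (b s : R) (z : R[i]) :
  complex.Im z ^+ 2 < b ^+ 2 ->
  `|(z - s%:C) ^+ 2| < `|(z - s%:C) ^+ 2 + (2 * b ^+ 2)%:C|.
Proof.
case: z => u y /= yb.
rewrite -(@ltr_pXn2r _ 2) ?nnegrE ?normr_ge0// -!add_Re2_Im2 ltcR /=.
have b0 : 0 < b ^+ 2 by rewrite (le_lt_trans _ yb) ?sqr_ge0.
have u0 := sqr_ge0 (u - s).
set v := u - s in u0 *; nra.
Qed.

Lemma node_product_in_disk (R : realType) (b : R) (n : nat) (x : 'I_n -> R)
    (k : 'I_n -> nat) (z : R[i]) :
  (0 < n)%N -> (forall j, (0 < k j)%N) -> complex.Im z ^+ 2 < b ^+ 2 ->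
  `|node_product (2 * b ^+ 2)%:C (fun j => (x j)%:C) k z| < 1.
Proof.
case: n x k => // n x k _ k0 zb.
have fac j : `|((z - (x j)%:C) ^+ 2 /
    ((z - (x j)%:C) ^+ 2 + (2 * b ^+ 2)%:C)) ^+ k j| < 1.
  rewrite normrX exprn_ilt1 ?normr_ge0 -?lt0n//.
  have lt := sqr_norm_lt_shift R b (x j) z zb.
  by rewrite normf_div ltr_pdivrMr ?mul1r// (le_lt_trans _ lt).
rewrite /node_product big_ord_recl normrM.
rewrite (le_lt_trans _ (fac ord0))// ler_piMr//.
rewrite normr_prod; apply: prodr_ile1 => j _.
by rewrite normr_ge0/= ltW.
Qed.

(** Each zero has twice the prescribed order: the square makes the factors
    nonnegative on the real line. *)
Lemma node_product_Fplus (R : realType) (b : R) (D : set R[i]) (n : nat)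
    (x : 'I_n -> R) (k : 'I_n -> nat) :
  (0 < n)%N -> (forall j, (0 < k j)%N) -> 0 < b ->
  (forall z, D z -> complex.Im z ^+ 2 < b ^+ 2) ->
  Fplus D x k
    (node_product (2 * b ^+ 2)%:C (fun j => (x j)%:C) k).
Proof.
move=> n0 k0 b0 Db; set g := node_product _ _ _.
set p : {poly R[i]} := \prod_(j < n) (('X - (x j)%:C%:P) ^+ 2) ^+ k j.
set q : {poly R[i]} :=
  \prod_(j < n) (('X - (x j)%:C%:P) ^+ 2 + (2 * b ^+ 2)%:C%:P) ^+ k j.
have gE : g = fun z => p.[z] / q.[z].
  by apply/funext => z; exact: node_product_rational.
have q0 z : complex.Im z ^+ 2 < b ^+ 2 -> q.[z] != 0.
  move=> zb; rewrite horner_prod; apply/prodf_neq0 => j _.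
  rewrite horner_exp hornerD horner_exp hornerXsubC hornerC expf_neq0//.
  rewrite -normr_gt0.
  exact: le_lt_trans (normr_ge0 _) (sqr_norm_lt_shift R b (x j) z zb).
split.
- move=> z /Db zb; split; last exact: node_product_in_disk.
  by rewrite gE; apply: ex_derive; apply: is_derive_rational; exact: q0.
- move=> j; rewrite gE; apply: vanishes_rational.
  + by apply: q0; rewrite /= expr0n/= exprn_gt0.
  + rewrite /p (bigD1 j)//= dvdp_mulr// -exprM dvdp_exp2l//.
    by rewrite mul2n -addnn leq_addr.
- move=> t _; rewrite /g node_product_real_complex ler0c.
  apply: prodr_ge0 => j _; rewrite exprn_ge0// divr_ge0 ?addr_ge0 ?sqr_ge0//.
  by rewrite mulr_ge0 ?sqr_ge0.
Qed.

(** * Jensen's inequality by monotonicity *)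

(** Induction on the exceptional set: the interval is cut at each exceptional
    point inside it, and the mean value theorem handles the pieces. *)
Lemma le_of_derive_ge0_off_finite (R : realType) (S : seq R) (f df : R -> R)
    (a b : R) :
  a <= b -> (forall t, a <= t <= b -> {for t, continuous f}) ->
  (forall t, a < t < b -> t \notin S -> is_derive t 1 f (df t)) ->
  (forall t, a < t < b -> t \notin S -> 0 <= df t) ->
  f a <= f b.
Proof.
elim: S a b => [|s S IH] a b ab cf dfE df0.
  have cfw : {within `[a, b], continuous f}.
    by apply: continuous_in_subspaceT => t; rewrite inE/= in_itv/=; exact: cf.
  move: ab; rewrite le_eqVlt => /predU1P[->//|ab].
  rewrite -subr_ge0.
  have [t|d dab ->] := @MVT R f df a b ab _ cfw.
    by rewrite in_itv/= => tab; exact: dfE.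
  by rewrite mulr_ge0 ?subr_ge0 ?(ltW ab)// df0//; move: dab; rewrite in_itv.
have sub c d : a <= c -> c <= d -> d <= b -> ~~ (c < s < d) -> f c <= f d.
  move=> ac cd db sN.
  have tN t : c < t < d -> t \notin S -> a < t < b /\ t \notin s :: S.
    move=> ctd tS; move/andP: (ctd) => [ct td].
    rewrite (le_lt_trans ac)// (lt_le_trans td)// inE negb_or tS.
    by split=> //; rewrite andbT; apply: contra sN => /eqP <-.
  apply: IH => // [t /andP[ct td]|t ctd tS|t ctd tS].
  - by apply: cf; rewrite (le_trans ac)// (le_trans td).
  - by have [] := tN t ctd tS; exact: dfE.
  - by have [] := tN t ctd tS; exact: df0.
have [/andP[as_ sb]|] := boolP (a < s < b); last exact: sub.
by rewrite (@le_trans _ _ (f s))// sub ?(ltW as_) ?(ltW sb)// ltxx ?andbF.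
Qed.

(** The integral is taken from a - 1 rather than a, so that the primitive is
    also differentiable, hence continuous, at the endpoint a. *)
Lemma continuous_has_primitive (R : realType) (f : R -> R) (a b : R) :
  a < b -> continuous f ->
  exists G : R -> R, [/\ forall t, a <= t <= b -> {for t, continuous G},
    forall t, a < t < b -> is_derive t 1 G (f t) &
    (\int[lebesgue_measure]_(t in `[a, b]) (f t)%:E = (G b - G a)%:E)%E].
Proof.
move=> ab cf; pose G x := (\int[lebesgue_measure]_(t in `[a - 1, x]) f t)%R.
have dG t : a - 1 < t -> is_derive t 1 G (f t).
  move=> at1; have t1 : t < t + 1 by rewrite ltrDl.
  have fi : lebesgue_measure.-integrable `[a - 1, t + 1] (EFin \o f).
    apply: continuous_compact_integrable; first exact: segment_compact.
    exact: continuous_subspaceT.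
  have [dGt <-] := continuous_FTC1_closed t1 fi at1 (cf t).
  by rewrite derive1E; exact: DeriveDef.
have cG t : a - 1 < t -> {for t, continuous G}.
  by move=> /dG[dGt _]; exact/differentiable_continuous/derivable1_diffP.
exists G; split.
- by move=> t /andP[at_ _]; apply: cG; lra.
- by move=> t /andP[at_ _]; apply: dG; lra.
- apply: continuous_FTC2 => //.
  + exact: continuous_subspaceT.
  + split.
    * move=> t; rewrite in_itv/= => /andP[at_ _].
      by have [] : is_derive t 1 G (f t) by apply: dG; lra.
    * by apply: cvg_at_right_filter; apply: cG; lra.
    * by apply: cvg_at_left_filter; apply: cG; lra.
  + move=> t; rewrite in_itv/= => /andP[at_ _]; rewrite derive1E.
    by apply: derive_val; apply: dG; lra.
Qed.

(** Jensen's inequality for exp, with the integral of u replaced by the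
    increment of a continuous U with U' = u off a finite set; u may thus be
    unbounded near that set. If m is the mean of u, then
    f >= exp u >= exp m * (1 + u - m), so a primitive of f minus one of the
    right-hand side is nondecreasing, and the mean of u - m is zero. *)
Lemma exp_mean_le_integral (R : realType) (S : seq R) (f u U : R -> R)
    (a b : R) :
  a < b -> continuous f -> continuous U ->
  (forall t, a < t < b -> t \notin S -> is_derive t 1 U (u t)) ->
  (forall t, a < t < b -> t \notin S -> expR (u t) <= f t) ->
  (((b - a) * expR ((U b - U a) / (b - a)))%:E <=
    \int[lebesgue_measure]_(t in `[a, b]) (f t)%:E)%E.
Proof.
move=> ab cf cU dU uf.
have [G [cG dG ->]] := continuous_has_primitive R f a b ab cf.
rewrite lee_fin; set m := (U b - U a) / (b - a).
pose W := G - expR m \*: ((1 - m) \*: id + U).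
have : W a <= W b.
  apply: (@le_of_derive_ge0_off_finite R S W
      (fun t => f t - expR m *: ((1 - m) *: 1 + u t))) (ltW ab) _ _ _.
  - move=> t tab; apply: cvgB; first exact: cG.
    by apply: cvgZr; apply: cvgD; [apply: cvgZr; exact: cvg_id|exact: cU].
  - move=> t tab tS.
    apply: is_deriveB; first exact: dG.
    by apply: is_deriveZ; apply: is_deriveD; exact: dU.
  - move=> t tab tS; rewrite subr_ge0 (le_trans _ (uf t tab tS))//.
    have -> : expR (u t) = expR m * expR (u t - m).
      by rewrite -expRD addrC subrK.
    rewrite /GRing.scale/= ler_pM2l ?expR_gt0//.
    by rewrite (le_trans _ (expR_ge1Dx _))//; lra.
have Um : U b - U a = m * (b - a) by rewrite divfK// subr_eq0 gt_eqF.
have WE t : W t = G t - expR m * ((1 - m) * t + U t) by [].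
rewrite !WE => WW.
have UbE : U b = m * (b - a) + U a by lra.
rewrite UbE in WW; lra.
Qed.

(** * A primitive of log (|t| / (|t| + A))^2 *)

Lemma ln_ge_1B_inv (R : realType) (y : R) : 0 < y -> 1 - y^-1 <= ln y.
Proof.
move=> y0; rewrite -[y in leRHS]invrK lnV ?posrE ?invr_gt0//.
have yi : 0 < y^-1 by rewrite invr_gt0.
have := @le_ln1Dx R (y^-1 - 1); rewrite [1 + _]addrC subrK.
by move=> /(_ ltac:(lra)); lra.
Qed.

(** At 0 the point is that x log x tends to 0: with x = r^2 and r <= 1,
    0 >= x log x = 2 r^2 log r >= 2 r^2 (1 - 1/r) >= - 2 r. To the left of 0 the
    function is 0, because [ln] is. *)
Lemma continuous_mul_ln (R : realType) (x : R) :
  0 <= x -> {for x, continuous (fun t : R => t * ln t)}.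
Proof.
rewrite le_eqVlt => /predU1P[<-|x0]; last first.
  by apply: cvgM; [exact: cvg_id | exact: continuous_ln].
rewrite /prop_for /continuous_at mul0r.
have sqrt0 : (fun t : R => Num.sqrt `|t|) @ (0 : R) --> (0 : R).
  rewrite -[X in _ --> X]sqrtr0 -[in X in _ --> X](@normr0 R R).
  apply: (@cvg_comp _ _ _ _ (@Num.sqrt R)); last exact: sqrt_continuous.
  exact: norm_continuous.
have bnd : \forall t \near (0 : R),
    - (2 * Num.sqrt `|t|) <= t * ln t <= 2 * Num.sqrt `|t|.
  near=> t.
  have t1 : `|t| <= 1 by near: t; exact: (@nbhs0_le R R 1 ltr01).
  have [t0|t0] := ltP 0 t; last first.
    by rewrite ln0// mulr0 oppr_le0 mulr_ge0 ?sqrtr_ge0.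
  rewrite gtr0_norm// in t1 *.
  have r0 : 0 < Num.sqrt t by rewrite sqrtr_gt0.
  have tE : t = Num.sqrt t ^+ 2 by rewrite sqr_sqrtr// ltW.
  set r := Num.sqrt t in r0 tE *.
  have tl : t * ln t = 2 * (r ^+ 2 * ln r) by rewrite tE lnXn// mulr2n; ring.
  have lr := ln_ge_1B_inv R r r0.
  have l0 : ln r <= 0 by apply: ln_le0; rewrite /r -sqrtr1 ler_wsqrtr.
  have rr : r ^+ 2 * (1 - r^-1) <= r ^+ 2 * ln r by rewrite ler_wpM2l ?sqr_ge0.
  have rE : r ^+ 2 * (1 - r^-1) = r ^+ 2 - r by field; rewrite gt_eqF.
  have r2 : 0 <= r ^+ 2 by rewrite sqr_ge0.
  have rl : r ^+ 2 * ln r <= 0 by rewrite mulr_ge0_le0.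
  by rewrite tl; apply/andP; split; lra.
apply: (squeeze_cvgr bnd).
- rewrite -[X in _ --> X]oppr0 -[X in _ --> - X](mulr0 2).
  by apply: cvgN; apply: cvgM => //; exact: cvg_cst.
- rewrite -[X in _ --> X](mulr0 2).
  by apply: cvgM => //; exact: cvg_cst.
Unshelve. all: by end_near. Qed.

(** For x >= 0 this is the integral of log (r / (r + A)) over [0, x]. *)
Definition log_ratio_primitive {R : realType} (A x : R) : R :=
  x * ln x - (x + A) * ln (x + A) + A * ln A.

(** The odd extension to the real line, doubled: a primitive of
    2 log (|t| / (|t| + A)) that is continuous at the singularity 0. The maxima
    select the positive and negative parts of t and make that continuity
    immediate. *)
Definition odd_log_ratio_primitive {R : realType} (A t : R) : R :=
  2 * (log_ratio_primitive A (Num.max t 0)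
       - log_ratio_primitive A (Num.max (- t) 0)).

Lemma log_ratio_primitive0 (R : realType) (A : R) :
  log_ratio_primitive A 0 = 0.
Proof. by rewrite /log_ratio_primitive mul0r !add0r addNr. Qed.

Lemma is_derive_log_ratio_primitive (R : realType) (A x : R) :
  0 < A -> 0 < x ->
  is_derive x 1 (log_ratio_primitive A) (ln (x / (x + A))).
Proof.
move=> A0 x0; have xA : 0 < x + A by rewrite addr_gt0.
have dlnA : is_derive x 1 (fun t => ln (t + A)) (x + A)^-1.
  have d1 : is_derive (x + A) 1 (@ln R) (x + A)^-1 by exact: is_derive1_ln.
  have d2 : is_derive x 1 (fun t => t + A) (1 + 0) by exact: is_deriveD.
  have := @is_derive1_comp R (@ln R) (fun t => t + A) x _ _ d1 d2.
  by rewrite addr0 mulr1.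
have dln := is_derive1_ln x0.
have : is_derive x 1 (id * (@ln R) - (id + cst A) * (fun t => ln (t + A))
   + cst (A * ln A)) (ln (x / (x + A))).
  apply: is_derive_eq; rewrite ln_div ?posrE// /GRing.scale/=.
  rewrite (_ : (id + cst A) x = x + A)//.
  by field; rewrite !gt_eqF.
by [].
Qed.

Lemma continuous_odd_log_ratio_primitive (R : realType) (A : R) :
  0 < A -> continuous (odd_log_ratio_primitive A).
Proof.
move=> A0 t.
have cP x : 0 <= x -> {for x, continuous (log_ratio_primitive A)}.
  move=> x0; apply: cvgD; last exact: cvg_cst.
  apply: cvgB; first exact: continuous_mul_ln.
  have cA : (fun t => t + A) @ x --> x + A.
    by apply: cvgD; [exact: cvg_id | exact: cvg_cst].
  apply: cvgM => //; apply: (@cvg_comp _ _ _ _ (@ln R) _ _ _ cA).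
  by apply: continuous_ln; rewrite ltr_wpDl.
have cmax (h : R -> R) : continuous h ->
    {for t, continuous (fun t => log_ratio_primitive A (Num.max (h t) 0))}.
  move=> ch.
  have cm : (fun t => Num.max (h t) 0) @ t --> Num.max (h t) 0.
    by apply: continuous_max; [exact: ch | exact: cvg_cst].
  apply: (@cvg_comp _ _ _ _ (log_ratio_primitive A) _ _ _ cm).
  by apply: cP; rewrite le_max lexx orbT.
apply: cvgM; first exact: cvg_cst.
apply: cvgB.
  by apply: (cmax id) => y; exact: cvg_id.
by apply: (cmax -%R) => y; apply: cvgN; exact: cvg_id.
Qed.

Lemma is_derive_odd_log_ratio_primitive (R : realType) (A s t : R) :
  0 < A -> t != s ->
  is_derive t 1 (fun t => odd_log_ratio_primitive A (t - s))
    (2 * ln (`|t - s| / (`|t - s| + A))).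
Proof.
move=> A0; rewrite neq_lt => /orP[ts|st].
- have st0 : 0 < s - t by rewrite subr_gt0.
  apply: (@near_eq_is_derive _ _ _
    ((-2) \*: (log_ratio_primitive A \o (fun t => s - t)))).
    near=> w; have ws : 0 < s - w by rewrite subr_gt0; near: w; exact: lt_nbhsl.
    rewrite /odd_log_ratio_primitive opprB [Num.max (w - s) 0]max_r; last lra.
    rewrite max_l ?(ltW ws)// log_ratio_primitive0 sub0r /=.
    by rewrite mulrN -mulNr.
  rewrite ltr0_norm ?subr_lt0// opprB.
  have d1 : is_derive t 1 (fun t => s - t) (0 - 1) by exact: is_deriveB.
  have d2 : is_derive (s - t) 1 (log_ratio_primitive A)
    (ln ((s - t) / (s - t + A))) by exact: is_derive_log_ratio_primitive.
  have := is_deriveZ (-2) (@is_derive1_comp R _ (fun t => s - t) t _ _ d2 d1).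
  by move=> d; apply: (is_derive_eq d); rewrite /GRing.scale/=; ring.
- have ts0 : 0 < t - s by rewrite subr_gt0.
  apply: (@near_eq_is_derive _ _ _
    (2 \*: (log_ratio_primitive A \o (fun t => t - s)))).
    near=> w; have ws : 0 < w - s by rewrite subr_gt0; near: w; exact: lt_nbhsr.
    rewrite /odd_log_ratio_primitive max_l ?(ltW ws)//.
    rewrite max_r ?oppr_le0 ?(ltW ws)//.
    by rewrite log_ratio_primitive0 subr0.
  rewrite gtr0_norm//.
  have d1 : is_derive t 1 (fun t => t - s) (1 - 0) by exact: is_deriveB.
  have d2 : is_derive (t - s) 1 (log_ratio_primitive A)
    (ln ((t - s) / (t - s + A))) by exact: is_derive_log_ratio_primitive.
  have := is_deriveZ 2 (@is_derive1_comp R _ (fun t => t - s) t _ _ d2 d1).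
  by move=> d; apply: (is_derive_eq d); rewrite /GRing.scale/=; ring.
Unshelve. all: by end_near. Qed.

(** Convexity: the graph lies above its tangent at 1. After cancellation this
    is Gibbs' inequality for the weights (x, A) and (1, A), each normalised by
    its total. It follows from log y >= 1 - 1/y at the ratios
    x (1 + A) / (x + A) and (1 + A) / (x + A). *)
Lemma log_ratio_primitive_tangent (R : realType) (A x : R) :
  0 < A -> 0 <= x ->
  log_ratio_primitive A 1 + (x - 1) * ln (1 / (1 + A))
    <= log_ratio_primitive A x.
Proof.
move=> A0 x0.
have xA : 0 < x + A by rewrite ltr_wpDl.
have A1 : 0 < 1 + A by rewrite addr_gt0.
rewrite /log_ratio_primitive ln1 mulr0 ln_div ?posrE// ln1.
have gA : A * (1 - ((1 + A) / (x + A))^-1) <= A * (ln (1 + A) - ln (x + A)).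
  by rewrite ler_pM2l// -ln_div ?posrE// ln_ge_1B_inv// divr_gt0.
have gx : x * (1 - (x * (1 + A) / (x + A))^-1)
    <= x * (ln x + ln (1 + A) - ln (x + A)).
  move: x0; rewrite le_eqVlt => /predU1P[<-|x0]; first by rewrite !mul0r.
  rewrite ler_pM2l// -lnM ?posrE// -ln_div ?posrE ?mulr_gt0//.
  by rewrite ln_ge_1B_inv// divr_gt0 ?mulr_gt0.
have : 0 <= A * (1 - ((1 + A) / (x + A))^-1)
    + x * (1 - (x * (1 + A) / (x + A))^-1).
  have [->|xn] := eqVneq x 0.
    rewrite mul0r addr0 mulr_ge0 ?(ltW A0)// subr_ge0 add0r.
    by rewrite invf_div ler_pdivrMr// mul1r; lra.
  by rewrite le_eqVlt; apply/orP; left; apply/eqP; field; rewrite xn !gt_eqF.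
lra.
Qed.

(** The increment is the integral over [-1, 1] of
    2 log (|t - s| / (|t - s| + A)). Adding the tangent inequalities at 1 - s
    and 1 + s, the linear terms cancel, and equality holds at the central node
    s = 0. *)
Lemma odd_log_ratio_primitive_increment (R : realType) (A s : R) :
  0 < A -> -1 <= s <= 1 ->
  4 * log_ratio_primitive A 1 <=
  odd_log_ratio_primitive A (1 - s) - odd_log_ratio_primitive A (-1 - s).
Proof.
move=> A0 /andP[s1 s2]; rewrite /odd_log_ratio_primitive.
rewrite [Num.max (1 - s) _]max_l; last lra.
rewrite [Num.max (- (1 - s)) _]max_r; last lra.
rewrite [Num.max (-1 - s) _]max_r; last lra.
rewrite [Num.max (- (-1 - s)) _]max_l; last lra.
rewrite log_ratio_primitive0.
have := @log_ratio_primitive_tangent R A (1 - s) A0.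
have := @log_ratio_primitive_tangent R A (- (-1 - s)) A0.
have -> : - (-1 - s) = 1 + s by ring.
by move=> /(_ ltac:(lra)) h1 /(_ ltac:(lra)) h2; lra.
Qed.

(** * The integral of the competitor *)

Lemma continuous_node_product (R : realType) (kappa : R) (n : nat)
    (x : 'I_n -> R) (k : 'I_n -> nat) :
  0 < kappa -> continuous (node_product kappa x k).
Proof.
move=> kappa0 t.
set p : {poly R} := \prod_(j < n) (('X - (x j)%:P) ^+ 2) ^+ k j.
set q : {poly R} := \prod_(j < n) (('X - (x j)%:P) ^+ 2 + kappa%:P) ^+ k j.
have gE : node_product kappa x k = fun z => p.[z] / q.[z].
  by apply/funext => z; exact: node_product_rational.
rewrite gE; apply/differentiable_continuous/derivable1_diffP.
apply: ex_derive; apply: is_derive_rational.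
rewrite horner_prod; apply/prodf_neq0 => j _.
rewrite horner_exp hornerD horner_exp hornerXsubC hornerC expf_neq0//.
by rewrite gt_eqF// ltr_wpDl ?sqr_ge0.
Qed.

(** Factor by factor, with r = |t - x_j|: r^2 + 2 b^2 <= (r + 2b)^2. *)
Lemma exp_log_ratio_le_node_product (R : realType) (b : R) (n : nat)
    (x : 'I_n -> R) (k : 'I_n -> nat) (t : R) :
  0 < b -> (forall j, t != x j) ->
  expR (\sum_(j < n)
    (k j)%:R * (2 * ln (`|t - x j| / (`|t - x j| + 2 * b))))
  <= node_product (2 * b ^+ 2) x k t.
Proof.
move=> b0 tx; rewrite expR_sum; apply: ler_prod => j _.
rewrite expR_ge0 /= expRM_natl lerXn2r ?nnegrE ?expR_ge0//.
  have k0 : 0 <= 2 * b ^+ 2 by rewrite mulr_ge0 ?sqr_ge0.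
  by rewrite divr_ge0 ?addr_ge0 ?k0 ?sqr_ge0.
have r0 : 0 < `|t - x j| by rewrite normr_gt0 subr_eq0 tx.
rewrite (expRM_natl 2) lnK; last first.
  by rewrite posrE divr_gt0// addr_gt0// mulr_gt0.
rewrite -(real_normK (num_real (t - x j))); set r := `|_| in r0 *.
rewrite expr_div_n ler_wpM2l ?sqr_ge0// lef_pV2 ?posrE.
- nra.
- by rewrite exprn_gt0// addr_gt0// mulr_gt0.
- by rewrite addr_gt0 ?mulr_gt0 ?exprn_gt0.
Qed.

Lemma integral_node_product_ge (R : realType) (b : R) (n : nat)
    (x : 'I_n -> R) (k : 'I_n -> nat) :
  0 < b -> (forall j, -1 <= x j <= 1) ->
  ((2 * expR ((2 * \sum_(j < n) k j)%:R * log_ratio_primitive (2 * b) 1))%:E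
  <= \int[lebesgue_measure]_(t in `[(-1)%R, 1%R])
       (node_product (2 * b ^+ 2) x k t)%:E)%E.
Proof.
move=> b0 x1; have A0 : 0 < 2 * b by rewrite mulr_gt0.
pose U : R -> R := \sum_(j < n)
  ((k j)%:R \*: (fun t => odd_log_ratio_primitive (2 * b) (t - x j))).
have UE t : U t = \sum_(j < n)
    (k j)%:R * odd_log_ratio_primitive (2 * b) (t - x j).
  by rewrite /U fct_sumE.
have cU : continuous U.
  rewrite /U; elim/big_ind: _ => [t|f g cf cg t|j _ t].
  - exact: cvg_cst.
  - by apply: cvgD; [exact: cf | exact: cg].
  - apply: cvgZr.
    apply: (@cvg_comp _ _ _ (fun t => t - x j) (odd_log_ratio_primitive (2 * b))
      _ (nbhs (t - x j))).
      by apply: cvgB; [exact: cvg_id | exact: cvg_cst].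
    exact: continuous_odd_log_ratio_primitive.
have k0 : 0 < 2 * b ^+ 2 by rewrite mulr_gt0 ?exprn_gt0.
have lt11 : -1 < 1 :> R by lra.
apply: le_trans (@exp_mean_le_integral R (codom x)
  (node_product (2 * b ^+ 2) x k)
  (fun t => \sum_(j < n)
    (k j)%:R * (2 * ln (`|t - x j| / (`|t - x j| + 2 * b))))
  U _ _ lt11 (continuous_node_product R _ n x k k0) cU _ _).
- rewrite lee_fin (_ : 1 - -1 = 2 :> R); last lra.
  rewrite ler_pM2l// ler_expR ler_pdivlMr// !UE -sumrB.
  rewrite natrM natr_sum mulrAC -mulrA mulr_sumr mulr_suml.
  apply: ler_sum => j _; rewrite -mulrBr.
  have := odd_log_ratio_primitive_increment R (2 * b) (x j) A0 (x1 j).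
  have := ler0n R (k j); set K := (k j)%:R; nra.
- move=> t _ tS; apply: is_derive_sum => j; apply: is_deriveZ.
  apply: is_derive_odd_log_ratio_primitive => //.
  by apply: contraNneq tS => ->; exact: codom_f.
- move=> t _ tS; apply: exp_log_ratio_le_node_product => // j.
  by apply: contraNneq tS => ->; exact: codom_f.
Qed.

Theorem corollary2 (R : realType) (c : R) (N : nat)
    (hc : 1 < c) (hN : (0 < N)%N) :
  ((2 * (((c ^+ 2 - 1 + c) / (c ^+ 2 - 1)) `^ ((c ^+ 2 - 1) / c)
         * ((c ^+ 2 - 1 + c) / c)) ^- (2 * N))%:E
   <= Jplus lebesgue_measure (ellipse c) N)%E.
Proof.
have c0 : 0 < c by lra.
have c21 : 0 < c ^+ 2 - 1 by nra.
pose b := (c ^+ 2 - 1) / (2 * c).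
have b0 : 0 < b by rewrite divr_gt0// mulr_gt0.
have strip z : ellipse c z -> complex.Im z ^+ 2 < b ^+ 2.
  rewrite /ellipse /= -/b => zc.
  rewrite -[ltRHS]mul1r -ltr_pdivrMr ?exprn_gt0//.
  by rewrite (le_lt_trans _ zc)// lerDr divr_ge0 ?sqr_ge0.
(* The base of the bound, with A = 2b, is (1 + 1/A)^A (1 + A). *)
have baseE : ((c ^+ 2 - 1 + c) / (c ^+ 2 - 1)) `^ ((c ^+ 2 - 1) / c)
    * ((c ^+ 2 - 1 + c) / c) = expR (- log_ratio_primitive (2 * b) 1).
  set A := (c ^+ 2 - 1) / c.
  have A0 : 0 < A by rewrite divr_gt0.
  have -> : 2 * b = A by rewrite /b /A; field; rewrite gt_eqF.
  have -> : (c ^+ 2 - 1 + c) / (c ^+ 2 - 1) = (1 + A) / A.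
    by rewrite /A; field; rewrite !gt_eqF.
  have -> : (c ^+ 2 - 1 + c) / c = 1 + A by rewrite /A; field; rewrite gt_eqF.
  have A1 : 0 < 1 + A by rewrite addr_gt0.
  rewrite /powR gt_eqF ?divr_gt0// -[X in _ * X]lnK ?posrE// -expRD.
  congr expR; rewrite ln_div ?posrE// /log_ratio_primitive ln1; ring.
apply/ereal_infP => _ [n [x [k [n0 x1 _ [k0 kN] ->]]]].
pose g := node_product (2 * b ^+ 2)%:C (fun j => (x j)%:C) k.
have gF : Fplus (ellipse c) x k g by exact: node_product_Fplus.
apply: (@le_trans _ _ `|\int[lebesgue_measure]_(t in `[(-1)%R, 1%R])
    (complex.Re (g t%:C))%:E|%E); last by apply: ereal_sup_ubound; exists g.
apply: le_trans (lee_abs _).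
under eq_integral do rewrite /g node_product_real_complex /=.
rewrite baseE expRN exprVn invrK -expRM_natl -kN.
exact: integral_node_product_ge.
Qed.
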